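(* Let $2\le m<n$ be integers, let $\alpha\in\mathbb{R}$, and let $E_{m,n}$ be the $m$-th elementary symmetric polynomial in $n$ variables. If $E_{m,n}^{-\alpha}$ is completely monotone on the positive orthant $\mathbb{R}_{>0}^n$, then $\alpha=0$ or $\alpha\ge\frac{n-m}{2}$.
   Context: $E_{m,n}(x)=\sum_{1\le i_1<\cdots<i_m\le n}x_{i_1}\cdots x_{i_m}$. A real-valued $\mathcal{C}^\infty$ function $f$ on the open positive orthant $\mathbb{R}^n_{>0}$ is called completely monotone if $(-1)^k\frac{\partial^k f}{\partial x_{i_1}\cdots\partial x_{i_k}}(x)\ge 0$ for all $x\in\mathbb{R}^n_{>0}$, all $k\ge 0$ and all indices $1\le i_1\le\cdots\le i_k\le n$. *)

(* Defs.v *)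
From mathcomp Require Import all_boot all_order all_algebra.
From mathcomp Require Import all_classical all_reals all_analysis.
Set Implicit Arguments.
Unset Strict Implicit.
Unset Printing Implicit Defensive.
Import Order.TTheory GRing.Theory Num.Theory.
Import numFieldNormedType.Exports.
Local Open Scope classical_set_scope.
Local Open Scope ring_scope.

Definition pos_orthant (R : realType) (n : nat) : set 'rV[R]_n :=
  [set x | forall i, 0 < x 0 i].

(* A set A of m indices stands for its increasing enumeration
   i_1 < ... < i_m. *)
Definition elem_sym (R : realType) (m n : nat) (x : 'rV[R]_n) : R :=
  \sum_(A : {set 'I_n} | #|A| == m) \prod_(i in A) x 0 i.

Definition partial (R : realType) (n : nat) (i : 'I_n) (f : 'rV[R]_n -> R) :
    'rV[R]_n -> R :=
  fun x => 'D_(delta_mx 0 i) f x.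

(* For s = [:: i_1; ...; i_k] this is d^k f / dx_{i_1} ... dx_{i_k}, the
   derivative in x_{i_k} being taken first. *)
Definition iter_partial (R : realType) (n : nat) (s : seq 'I_n)
    (f : 'rV[R]_n -> R) : 'rV[R]_n -> R :=
  foldr (@partial R n) f s.

(* Functions on the open orthant are represented by functions on the whole
   space. As the orthant is open, only the values of f on the orthant matter in
   the next two definitions. *)
Definition smooth_on_orthant (R : realType) (n : nat) (f : 'rV[R]_n -> R) :
    Prop :=
  forall (s : seq 'I_n) (x : 'rV[R]_n), @pos_orthant R n x ->
    {for x, continuous (iter_partial s f)} /\
    (forall i : 'I_n, derivable (iter_partial s f) x (delta_mx 0 i)).

Definition completely_monotone (R : realType) (n : nat) (f : 'rV[R]_n -> R) :
    Prop :=
  smooth_on_orthant f /\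
  forall (s : seq 'I_n) (x : 'rV[R]_n),
    sorted (fun i j : 'I_n => (i <= j)%N) s -> @pos_orthant R n x ->
    0 <= (-1) ^+ size s * iter_partial s f x.

(* Main.v *)
Require Import Defs.
From mathcomp Require Import all_boot all_order all_algebra.
From mathcomp Require Import all_classical all_reals all_analysis.
From mathcomp Require Import ring lra zify.
Import Order.TTheory GRing.Theory Num.Theory.
Import numFieldNormedType.Exports.
Local Open Scope ring_scope.

(** Dividing by a power of the variable and letting [m - 2] of the variables
    tend to infinity turns [E_{m,n}] into the quadratic form [E_{2,N}],
    [N = n - m + 2], in the remaining ones; complete monotonicity, in the form of
    sign conditions on finite differences, survives this limit. So it suffices to bound the exponents [alpha] for which
    [F = E_{2,N} `^ (- alpha)] is completely monotone.

    A negative [alpha] is excluded because [F] would then increase. For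
    [alpha > 0], were [F] the Laplace transform of a positive measure [mu] on the
    orthant, every polynomial [p] would satisfy
      [p(- d/dx)^2 F (x) = \int p(y)^2 e^{- <x, y>} dmu(y) >= 0].
    The polynomial [p(y) = \sum_k y_k^2 - c (\sum_k y_k)^2] decides the matter.
    At [x = (1, ..., 1)], for the value of [c] that minimises the left-hand side,
    this side is a positive multiple of [2 alpha + 2 - N] ([quartic_value]), so
    that [alpha >= (N - 2) / 2 = (n - m) / 2]. That [p] suffices can be
    understood as follows. The homogeneity of [F] reduces [mu] to a distribution
    on the simplex [\sum_k y_k = 1], in which the squared distance to the
    barycentre has, up to scale, the moments of a Beta distribution with
    parameters [(N - 1) / 2] and [alpha - (N - 2) / 2]; the number computed is
    its variance, which is negative when the second parameter is negative (and
    the sum of both exceeds [1/2]).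

    No measure is constructed. Complete monotonicity makes all iterated finite
    differences nonnegative, by the mean value theorem
    ([completely_monotone_nablas]), and [F] inherits this as a limit
    ([diff_monotone_esym2]); a Bernstein polynomial argument, one
    coordinate at a time, deduces that the kernel [F (x + y)] is positive
    semidefinite on every lattice ([diff_monotone_psd]). Testing it on a
    combination of points [1 + h v] that discretises [p(- d/dx)] and taking the
    leading term as [h] tends to [0] yields the displayed inequality
    ([quartic_test]). *)

Set Implicit Arguments.
Unset Strict Implicit.
Unset Printing Implicit Defensive.

(** * Finite differences of completely monotone functions *)

Definition nabla (R : realType) n (h : R) (i : 'I_n) (g : 'rV[R]_n -> R) :
    'rV[R]_n -> R :=
  fun x => g x - g (x + h *: delta_mx 0 i).

Definition nablas (R : realType) n (h : R) (s : seq 'I_n) (g : 'rV[R]_n -> R) :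
    'rV[R]_n -> R :=
  foldr (nabla h) g s.

Definition nonneg (R : realType) n : set 'rV[R]_n := [set x | forall i, 0 <= x 0 i].

Lemma pos_orthantD (R : realType) n (x v : 'rV[R]_n) :
  pos_orthant x -> nonneg v -> pos_orthant (x + v).
Proof. by move=> x0 v0 i; rewrite mxE ltr_wpDr. Qed.

Lemma nonnegD (R : realType) n (v w : 'rV[R]_n) :
  nonneg v -> nonneg w -> nonneg (v + w).
Proof. by move=> v0 w0 i; rewrite mxE addr_ge0. Qed.

Lemma nonnegZ (R : realType) n (a : R) (v : 'rV[R]_n) :
  0 <= a -> nonneg v -> nonneg (a *: v).
Proof. by move=> a0 v0 i; rewrite mxE mulr_ge0. Qed.

Lemma nonneg_delta (R : realType) n (i : 'I_n) : nonneg (delta_mx 0 i : 'rV[R]_n).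
Proof. by move=> j; rewrite mxE ler0n. Qed.

Lemma nonneg_step (R : realType) n (a : R) (i : 'I_n) :
  0 <= a -> nonneg (a *: (delta_mx 0 i : 'rV[R]_n)).
Proof. by move=> a0; apply: nonnegZ => //; exact: nonneg_delta. Qed.

Lemma nablaC (R : realType) n (h : R) (i j : 'I_n) (g : 'rV[R]_n -> R) :
  nabla h i (nabla h j g) = nabla h j (nabla h i g).
Proof. by apply/funext => x; rewrite /nabla [x + _ + _]addrAC; ring. Qed.

Lemma nablas_nabla (R : realType) n (h : R) s (j : 'I_n) (g : 'rV[R]_n -> R) :
  nablas h s (nabla h j g) = nabla h j (nablas h s g).
Proof. by elim: s => //= i s ->; exact: nablaC. Qed.

Lemma nablasN (R : realType) n (h : R) (s : seq 'I_n) (g : 'rV[R]_n -> R) :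
  nablas h s (fun x => - g x) = fun x => - nablas h s g x.
Proof.
by elim: s => //= i s ->; apply/funext => x; rewrite /nabla opprD.
Qed.

(** Needed because derivatives are only controlled on the orthant, while
    [nablas] is an operator on functions defined everywhere. *)
Lemma nablas_eq (R : realType) n (h : R) (s : seq 'I_n) (f g : 'rV[R]_n -> R) :
  0 <= h -> (forall x, pos_orthant x -> f x = g x) ->
  forall x, pos_orthant x -> nablas h s f x = nablas h s g x.
Proof.
move=> h0 fg; elim: s => //= i s IH x x0; rewrite /nabla !IH//.
by apply: pos_orthantD => //; exact: nonneg_step.
Qed.

Lemma is_derive_line (R : realType) n (g : 'rV[R]_n -> R) (x v : 'rV[R]_n) (t : R) :
  derivable g (x + t *: v) v ->
  is_derive t 1 (fun r : R => g (x + r *: v)) ('D_v g (x + t *: v)).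
Proof.
set q := (fun r : R => g (x + r *: v)).
have E : (fun h : R => h^-1 *: (q (h *: 1 + t) - q t)) =
   (fun h : R => h^-1 *: (g (h *: v + (x + t *: v)) - g (x + t *: v))).
  apply/funext => h; rewrite /q; congr (_ *: (g _ - _)).
  by rewrite scalerDl addrCA; congr (_ + (_ + _)); rewrite /GRing.scale/= mulr1.
move=> dg; apply: DeriveDef; first by rewrite /derivable E.
by rewrite /derive E.
Qed.

(** A difference operator is a combination of translations, and these commute
    with directional derivatives. *)
Lemma nablas_derive (R : realType) n (h : R) (i : 'I_n) s (g : 'rV[R]_n -> R) :
  0 < h -> (forall x, pos_orthant x -> derivable g x (delta_mx 0 i)) ->
  forall x, pos_orthant x -> is_derive x (delta_mx 0 i) (nablas h s g)
     (nablas h s (partial i g) x).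
Proof.
move=> h0 dg; elim: s => [|j s IH] x x0 /=.
  by apply: DeriveDef => //; exact: dg.
rewrite /nabla; apply: is_deriveB; first exact: IH.
have x'0 : pos_orthant (x + h *: delta_mx 0 j).
  by apply: pos_orthantD => //; apply: nonneg_step; exact: ltW.
have [d1 d2] := IH _ x'0.
set u := nablas h s g in d1 d2 *.
have E : (fun k : R => k^-1 *: (u (k *: delta_mx 0 i + x + h *: delta_mx 0 j) -
    u (x + h *: delta_mx 0 j))) = (fun k : R => k^-1 *: (u (k *: delta_mx 0 i +
   (x + h *: delta_mx 0 j)) - u (x + h *: delta_mx 0 j))).
  by apply/funext => k; rewrite addrA.
apply: DeriveDef; first by rewrite /derivable E.
by rewrite /derive E.
Qed.

Lemma nabla_ge0 (R : realType) n (h : R) (i : 'I_n) (g : 'rV[R]_n -> R) :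
  0 < h -> (forall x, pos_orthant x -> derivable g x (delta_mx 0 i)) ->
  (forall x, pos_orthant x -> partial i g x <= 0) ->
  forall x, pos_orthant x -> 0 <= nabla h i g x.
Proof.
move=> h0 dg dg0 x x0; set v : 'rV[R]_n := delta_mx 0 i in dg *.
have xt (t : R) : 0 <= t -> pos_orthant (x + t *: v).
  by move=> t0; apply: pos_orthantD => //; exact: nonneg_step.
pose q := (fun r : R => g (x + r *: v)).
have dq (t : R) : 0 <= t -> is_derive t 1 q ('D_v g (x + t *: v)).
  by move=> t0; apply: is_derive_line; apply: dg; exact: xt.
suff : q h <= q 0 by rewrite /q /nabla scale0r addr0 subr_ge0.
apply: (@ler0_derive1_nincr _ q 0 h) => //; last exact: ltW.
- by move=> t; rewrite in_itv/= => /andP[/ltW t0 _]; have [] := dq _ t0.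
- move=> t; rewrite in_itv/= => /andP[/ltW t0 _].
  by rewrite derive1E; have [_ ->] := dq _ t0; apply: dg0; exact: xt.
- apply: derivable_within_continuous => t; rewrite in_itv/= => /andP[t0 _].
  by have [] := dq _ t0.
Qed.

(** Differences are traded for derivatives one at a time, starting with the
    innermost one: a difference in direction [i] has the sign of [- d/dx_i] by
    the mean value theorem, and that derivative commutes with the outer
    differences. The induction therefore mixes differences [r] and derivatives
    [s]. Moving the last element of [r] to the front of [s] leaves [r ++ s], and
    hence its being sorted, unchanged. *)
Lemma completely_monotone_nablas (R : realType) n (h : R) (f : 'rV[R]_n -> R) :
  0 < h -> completely_monotone f ->
  forall r x, sorted (fun i j : 'I_n => (i <= j)%N) r -> pos_orthant x ->
  0 <= nablas h r f x.
Proof.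
move=> h0 [sf cf].
suff H r s : sorted (fun i j : 'I_n => (i <= j)%N) (r ++ s) ->
    forall x, pos_orthant x ->
    0 <= nablas h r (fun x => (-1) ^+ size s * iter_partial s f x) x.
  move=> r x sr x0; have := H r [::]; rewrite cats0 => /(_ sr x x0).
  by rewrite /=; under [X in nablas h r X]eq_fun do rewrite expr0 mul1r.
elim/last_ind: r s => [|r i IH] s.
  by move=> ss x x0; exact: cf.
rewrite cat_rcons => rs x x0.
rewrite /nablas foldr_rcons -/(nablas h r _) nablas_nabla.
have ds y : pos_orthant y -> derivable (iter_partial s f) y (delta_mx 0 i).
  by move=> y0; have [_] := sf s y y0; exact.
set G := fun x => _.
have dG y : pos_orthant y -> is_derive y (delta_mx 0 i) G
    (- ((-1) ^+ size (i :: s) * iter_partial (i :: s) f y)).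
  move=> y0; rewrite /= exprS -mulrA mulN1r opprK; apply: is_deriveZ.
  by apply: DeriveDef => //; exact: ds.
have dG' y : pos_orthant y -> derivable G y (delta_mx 0 i).
  by move=> /dG[].
have dn := @nablas_derive _ _ h i r G h0 dG'.
apply: nabla_ge0 => // y y0; first by have [] := dn _ y0.
have -> : partial i (nablas h r G) y = nablas h r (partial i G) y.
  by have [] := dn _ y0.
rewrite (@nablas_eq _ _ h r _ (fun x => - ((-1) ^+ size (i :: s) *
    iter_partial (i :: s) f x)) (ltW h0))//.
  by rewrite nablasN oppr_le0; exact: IH.
by move=> z /dG[].
Qed.

(** All iterated differences along the directions in [l], in any number, are
    nonnegative on the orthant. The recursion on [l] is what allows the
    coordinates to be eliminated one after the other. *)
Fixpoint diff_monotone (R : realType) n (h : R) (l : seq 'I_n)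
    (g : 'rV[R]_n -> R) : Prop :=
  if l is i :: l' then forall k, diff_monotone h l' (iter k (nabla h i) g)
  else forall x, pos_orthant x -> 0 <= g x.

Lemma iter_nablas (R : realType) n (h : R) k (i : 'I_n) s (g : 'rV[R]_n -> R) :
  iter k (nabla h i) (nablas h s g) = nablas h (nseq k i ++ s) g.
Proof. by elim: k => //= k ->. Qed.

(** The list is decreasing because the head of [l] is the innermost difference,
    whereas the sequences of [completely_monotone_nablas] have their largest
    index innermost. *)
Lemma completely_monotone_diff_monotone (R : realType) n (h : R) (f : 'rV[R]_n -> R) :
  0 < h -> completely_monotone f -> diff_monotone h (rev (enum 'I_n)) f.
Proof.
move=> h0 cf.
suff H (l s : seq 'I_n) : sorted (fun i j : 'I_n => (i <= j)%N) s ->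
    sorted (fun i j : 'I_n => (j <= i)%N) l ->
    {in l & s, forall i j : 'I_n, (i <= j)%N} -> diff_monotone h l (nablas h s f).
  apply: (H _ [::]) => //; rewrite rev_sorted.
  have := iota_sorted 0 n; rewrite -val_enum_ord sorted_map.
  by apply: sub_sorted => i j.
elim: l s => [|i l IH] s ss sl ls /=.
  by move=> x x0; exact: (completely_monotone_nablas h0 cf).
have tr : transitive (fun i j : 'I_n => (i <= j)%N) by move=> a b c /leq_trans; exact.
have tr' : transitive (fun i j : 'I_n => (j <= i)%N).
  by move=> a b c ba ac; exact: leq_trans ac ba.
move: sl; rewrite /= (path_sortedE tr') => /andP[/allP il sl] k.
rewrite iter_nablas; apply: IH => //.
- elim: k => //= k IHk; rewrite (path_sortedE tr) IHk andbT.
  apply/allP => j; rewrite mem_cat => /orP[/nseqP[-> _]//|js].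
  by apply: ls => //; rewrite inE eqxx.
- move=> a b al; rewrite mem_cat => /orP[/nseqP[-> _]|bs]; first exact: il.
  by apply: ls => //; rewrite inE al orbT.
Qed.

Lemma iter_nabla_shift (R : realType) n (h : R) k (i : 'I_n) (g : 'rV[R]_n -> R) v :
  iter k (nabla h i) (fun x => g (x + v)) = fun x => iter k (nabla h i) g (x + v).
Proof.
elim: k => //= k ->; apply/funext => x; rewrite /nabla.
by rewrite (addrAC x v).
Qed.

Lemma diff_monotone_shift (R : realType) n (h : R) l (g : 'rV[R]_n -> R) v :
  nonneg v -> diff_monotone h l g -> diff_monotone h l (fun x => g (x + v)).
Proof.
move=> v0; elim: l g => [|i l IH] g /= ng.
  by move=> x x0; apply: ng; exact: pos_orthantD.
by move=> k; rewrite iter_nabla_shift; apply: IH; exact: ng.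
Qed.

Lemma iter_nabla_scale (R : realType) n (h : R) k (i : 'I_n) (g : 'rV[R]_n -> R) c :
  iter k (nabla h i) (fun x => c * g x) = fun x => c * iter k (nabla h i) g x.
Proof.
by elim: k => //= k ->; apply/funext => x; rewrite /nabla mulrBr.
Qed.

Lemma diff_monotone_scale (R : realType) n (h : R) l (g : 'rV[R]_n -> R) c :
  0 <= c -> diff_monotone h l g -> diff_monotone h l (fun x => c * g x).
Proof.
move=> c0; elim: l g => [|i l IH] g /= ng.
  by move=> x x0; apply: mulr_ge0 => //; exact: ng.
by move=> k; rewrite iter_nabla_scale; apply: IH; exact: ng.
Qed.

Lemma diff_monotone_ge0 (R : realType) n (h : R) l (g : 'rV[R]_n -> R) x :
  diff_monotone h l g -> pos_orthant x -> 0 <= g x.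
Proof.
by elim: l g => [|i l IH] g /= ng x0; [exact: ng | apply: IH => //; exact: (ng 0%N)].
Qed.

Lemma diff_monotone_lim (R : realType) n (h : R) l (u : nat -> 'rV[R]_n -> R) g :
  0 <= h -> (forall k, diff_monotone h l (u k)) ->
  (forall x, pos_orthant x -> (u k x @[k --> \oo] --> g x)%classic) ->
  diff_monotone h l g.
Proof.
move=> h0; elim: l u g => [|i l IH] u g /= nu ug.
  move=> x x0; have ugx := ug _ x0.
  rewrite -(cvg_lim (@Rhausdorff R) ugx).
  apply: limr_ge; first by apply/cvg_ex; exists (g x).
  by apply: nearW => k; exact: nu.
move=> k; apply: (IH (fun j => iter k (nabla h i) (u j))); first by move=> j.
elim: k => [//|k IHk] x x0 /=; rewrite /nabla; apply: cvgB; first exact: IHk.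
by apply: IHk; apply: pos_orthantD => //; exact: nonneg_step.
Qed.

Lemma diff_monotone_nabla (R : realType) n (h : R) l (g : 'rV[R]_n -> R) i x :
  diff_monotone h l g -> i \in l -> pos_orthant x -> 0 <= nabla h i g x.
Proof.
elim: l g => [//|j l IH] g /= ng; rewrite inE => /orP[/eqP ->|il] x0.
  by apply: diff_monotone_ge0 x0; exact: (ng 1%N).
by apply: IH => //; exact: (ng 0%N).
Qed.


(** * Positive semidefiniteness on lattices *)

Lemma sum_binS (R : realType) r (a : nat -> R) :
  \sum_(j < r.+2) 'C(r.+1, j)%:R * a j =
  \sum_(j < r.+1) 'C(r, j)%:R * (a j + a j.+1).
Proof.
rewrite big_ord_recl /=.
under eq_bigr => j _ do rewrite /bump /= add1n binS natrD mulrDl.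
under [RHS]eq_bigr => j _ do rewrite mulrDr.
rewrite !big_split /= addrA; congr (_ + _).
rewrite big_ord_recr /= (bin_small (ltnSn r)) mul0r addr0 [RHS]big_ord_recl /=.
by rewrite !bin0.
Qed.

(** The binomial theorem for [1 = E + (1 - E)], [E] being the shift: [F a j]
    stands for the [a]-th difference of a sequence, at [j]. *)
Lemma newton_backward (R : realType) (F : nat -> nat -> R) r b :
  (forall a j, F a.+1 j = F a j - F a j.+1) ->
  \sum_(j < r.+1) 'C(r, j)%:R * F (r - j)%N (b + j)%N = F 0%N b.
Proof.
move=> FS; elim: r => [|r IH].
  by rewrite big_ord_recl big_ord0 /= bin0 mul1r addn0 addr0.
rewrite (sum_binS _ (fun j => F (r.+1 - j)%N (b + j)%N)) -[RHS]IH.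
apply: eq_bigr => j _; congr (_ * _).
have jr : (j <= r)%N by rewrite -ltnS.
by rewrite subSn// FS subSS addnS subrK.
Qed.

Lemma ffact_addr b j r : ((b + r) ^_ (b + j) = (b + r) ^_ b * r ^_ j)%N.
Proof.
elim: b => [|b IH]; first by rewrite ffactn0 mul1n.
by rewrite !addSn !ffactSS IH mulnA.
Qed.

Lemma ffact_bin b j r : ((b + j) ^_ b * 'C(b + r, b + j) = (b + r) ^_ b * 'C(r, j))%N.
Proof.
apply/eqP; rewrite -(eqn_pmul2r (fact_gt0 j)); apply/eqP.
rewrite mulnAC [LHS]mulnC -[RHS]mulnA.
have -> : ((b + j) ^_ b * j`! = (b + j)`!)%N.
  by rewrite -{2}(addKn b j) ffact_fact// leq_addr.
by rewrite bin_ffact ffact_addr bin_ffact.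
Qed.

(** The Bernstein expansion of the monomial [t ^ b], where [F 0 b] plays the
    role of its moment. The falling factorials make it exact, whereas [(J / k) ^ b]
    would only give it in the limit. *)
Lemma bernstein_monomial (R : realType) (F : nat -> nat -> R) k b :
  (forall a j, F a.+1 j = F a j - F a j.+1) -> (b <= k)%N ->
  \sum_(J < k.+1) (J ^_ b)%:R / (k ^_ b)%:R * ('C(k, J)%:R * F (k - J)%N J)
  = F 0%N b.
Proof.
move=> FS bk; rewrite -[RHS](newton_backward (k - b) b FS).
rewrite -(big_mkord xpredT (fun J => (J ^_ b)%:R / (k ^_ b)%:R *
  ('C(k, J)%:R * F (k - J)%N J))) (@big_cat_nat _ _ _ b) ?leqW//=.
rewrite big_nat big1 ?add0r; last first.
  by move=> j /= jb; rewrite ffact_small// !mul0r.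
rewrite -{1}(add0n b) big_addn subSn// big_mkord; apply: eq_bigr => j _.
have k0 : (k ^_ b)%:R != 0 :> R by rewrite pnatr_eq0 -lt0n ffact_gt0.
have jk : (j <= k - b)%N by rewrite -ltnS.
have -> : (k - (j + b) = k - b - j)%N by rewrite addnC subnDA.
rewrite (addnC j b) mulrA; congr (_ * _).
have := ffact_bin b j (k - b); rewrite subnKC// => /(congr1 (fun u => u%:R : R)).
rewrite !natrM => E.
by rewrite mulrAC E mulrAC divff// mul1r.
Qed.

(** The uniform error made in replacing the exact Bernstein coefficients by
    values of the monomial; these are multiplicative in [b], which the
    falling factorials are not. *)
Lemma ffact_ratio (R : realType) B k J b : (b <= B)%N -> (B < k)%N -> (J <= k)%N ->
  `|(J ^_ b)%:R / (k ^_ b)%:R - (J%:R / k%:R) ^+ b| <= (b * B)%:R / (k - B)%:R :> R.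
Proof.
move=> + Bk Jk; elim: b => [|b IH] bB.
  by rewrite !ffactn0 divr1 expr0 subrr normr0 mul0n mul0r.
have {}IH := IH (ltnW bB).
rewrite !ffactnSr !natrM.
set s : R := (J - b)%:R / (k - b)%:R; set q : R := J%:R / k%:R in IH *.
set rho : R := (J ^_ b)%:R / (k ^_ b)%:R in IH *.
have k0 : 0 < k%:R :> R by rewrite ltr0n; lia.
have kB0 : 0 < (k - B)%:R :> R by rewrite ltr0n; lia.
have kb0 : 0 < (k - b)%:R :> R by rewrite ltr0n; lia.
have q01 : 0 <= q <= 1.
  by rewrite divr_ge0 ?ler0n//= ler_pdivrMr// mul1r ler_nat.
have s01 : 0 <= s <= 1.
  by rewrite divr_ge0 ?ler0n//= ler_pdivrMr// mul1r ler_nat leq_sub2r.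
have -> : (J ^_ b)%:R * (J - b)%:R / ((k ^_ b)%:R * (k - b)%:R) = rho * s :> R.
  by rewrite invfM mulrACA.
have -> : rho * s - q ^+ b.+1 = (rho - q ^+ b) * s + q ^+ b * (s - q).
  by rewrite exprSr; ring.
have sq : `|s - q| <= B%:R / (k - B)%:R.
  have H : `|s - q| <= b%:R / (k - b)%:R.
    have [Jb|bJ] := leqP J b.
      have -> : s = 0 by rewrite /s (eqP (_ : J - b == 0)%N) ?mul0r.
      rewrite sub0r normrN ger0_norm; last by case/andP: q01.
      rewrite ler_pM ?invr_ge0 ?ler0n ?ler_nat// lef_pV2 ?posrE//.
      by rewrite ler_nat leq_subr.
    have -> : s - q = - (b%:R / (k - b)%:R * (1 - q)).
      rewrite /s /q natrB 1?ltnW// natrB ?(leq_trans (ltnW bJ))//.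
      have kb' : k%:R - b%:R != 0 :> R.
        by rewrite -natrB ?gt_eqF//; lia.
      by field; rewrite kb' gt_eqF.
    rewrite normrN ger0_norm; last first.
      by rewrite mulr_ge0 ?divr_ge0 ?ler0n// subr_ge0; case/andP: q01.
    rewrite ler_piMr ?divr_ge0 ?ler0n// gerBl; by case/andP: q01.
  apply: (le_trans H); rewrite ler_pM ?invr_ge0 ?ler0n ?ler_nat//; first lia.
  by rewrite lef_pV2 ?posrE// ler_nat; lia.
clearbody s q.
rewrite -natr1 [(b%:R + 1) * _]mulrDl mul1r [X in _ <= X]mulrDl -natrM.
apply: le_trans (ler_normD _ _) _; rewrite !normrM; apply: lerD.
  apply: le_trans IH; rewrite ler_piMr ?normr_ge0//.
  by case/andP: s01 => s0 s1; rewrite ger0_norm.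
apply: le_trans sq; rewrite ler_piMl ?normr_ge0//.
by case/andP: q01 => q0 q1; rewrite ger0_norm ?exprn_ge0 ?exprn_ile1.
Qed.

Definition lattice_pt (R : realType) n (l : seq 'I_n) (b : 'I_n -> nat) : 'rV[R]_n :=
  \sum_(i <- l) (b i)%:R *: delta_mx 0 i.

Lemma nonneg_lattice_pt (R : realType) n (l : seq 'I_n) b :
  nonneg (lattice_pt R l b).
Proof.
rewrite /lattice_pt; elim/big_ind: _ => [i|u v|i _]; first by rewrite mxE.
- exact: nonnegD.
- exact: nonneg_step.
Qed.

Lemma lattice_ptE (R : realType) n (b : 'I_n -> nat) :
  lattice_pt R (rev (enum 'I_n)) b = \row_i (b i)%:R.
Proof.
rewrite /lattice_pt (perm_big (enum 'I_n)) ?perm_rev//= big_enum /=.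
apply/rowP => i; rewrite summxE mxE (bigD1 i) //= !mxE !eqxx mulr1.
by rewrite big1 ?addr0// => j ji; rewrite !mxE eq_sym (negPf ji) mulr0.
Qed.

(** Were [g] an integral of functions [y |-> \prod_i t_i ^ (y_i / h)] with
    [t_i \in [0, 1]] against a positive measure, this would be the integral of a
    square. The measure is replaced, in the coordinate [i], by its Bernstein
    approximation: [g] is, up to [O(1 / k)], a combination of the functions [W J]
    with weights [(J / k) ^ b], where the [W J] are themselves difference
    monotone along the remaining coordinates. Multiplicativity of the weights in
    [b] lets them be absorbed in the coefficients [c], and the induction
    hypothesis applies to each [W J]. *)
Lemma diff_monotone_psd (R : realType) n (h : R) l (g : 'rV[R]_n -> R) :
  0 <= h -> diff_monotone h l g ->
  forall (I : finType) (c : I -> R) (b : I -> 'I_n -> nat) x, pos_orthant x ->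
  0 <= \sum_p \sum_q c p * c q *
         g (x + h *: (lattice_pt R l (b p) + lattice_pt R l (b q))).
Proof.
move=> h0; elim: l g => [|i l IH] g /=.
  move=> g0 I c b x x0; rewrite /lattice_pt.
  under eq_bigr => p _ do under eq_bigr => q _ do
    rewrite !big_nil addr0 scaler0 addr0.
  have -> : \sum_p \sum_q c p * c q * g x = (\sum_p c p) ^+ 2 * g x.
    rewrite expr2 big_distrlr mulr_suml; apply: eq_bigr => p _.
    by rewrite mulr_suml.
  by rewrite mulr_ge0 ?sqr_ge0//; exact: g0.
move=> ng I c b x x0.
pose X p q := x + h *: (lattice_pt R l (b p) + lattice_pt R l (b q)).
have X0 p q : pos_orthant (X p q).
  apply: pos_orthantD => //; apply: nonnegZ => //.
  by apply: nonnegD; exact: nonneg_lattice_pt.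
pose F y a j : R := iter a (nabla h i) g (y + (h * j%:R) *: delta_mx 0 i).
have FS y a j : F y a.+1 j = F y a j - F y a j.+1.
  rewrite /F /= {1}/nabla; congr (_ - iter a _ g _).
  by rewrite -addrA -scalerDl -[X in (_ + X) *: _](mulr1 h) -mulrDr natr1.
have F0 y : F y 0%N 0%N = g y by rewrite /F /= mulr0 scale0r addr0.
set T := \sum_p _.
have -> : T = \sum_p \sum_q c p * c q * F (X p q) 0%N (b p i + b q i)%N.
  apply: eq_bigr => p _; apply: eq_bigr => q _; congr (_ * g _).
  rewrite /lattice_pt !big_cons -/(lattice_pt R l (b p)) -/(lattice_pt R l (b q)).
  rewrite addrACA -scalerDl -natrD scalerDr scalerA /X -addrA.
  by rewrite [X in _ + X = _]addrC.
move=> {T}; set T := \sum_p _.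
pose B := (\max_p b p i + \max_q b q i)%N.
have bB p q : (b p i + b q i <= B)%N.
  by apply: leq_add; [apply: (leq_bigmax p) | apply: (leq_bigmax q)].
pose M := \sum_p \sum_q `|c p * c q| * g (X p q).
have TM k : (B < k)%N -> 0 <= T + (B * B)%:R / (k - B)%:R * M.
  move=> Bk.
  pose W J y := 'C(k, J)%:R * F y (k - J)%N J.
  have nW (J : nat) : diff_monotone h l (W J).
    apply: diff_monotone_scale; rewrite ?ler0n//.
    apply: (@diff_monotone_shift _ _ h l (iter (k - J) (nabla h i) g)); last exact: ng.
    by apply: nonneg_step; rewrite mulr_ge0.
  have -> : T = \sum_(J < k.+1) \sum_p \sum_q c p * c q *
      ((J ^_ (b p i + b q i))%:R / (k ^_ (b p i + b q i))%:R * W J (X p q)).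
    rewrite exchange_big /=; apply: eq_bigr => p _.
    rewrite exchange_big /=; apply: eq_bigr => q _.
    rewrite -mulr_sumr bernstein_monomial//.
    by rewrite (leq_trans (bB p q))// ltnW.
  have -> : M = \sum_(J < k.+1) \sum_p \sum_q `|c p * c q| * W J (X p q).
    rewrite exchange_big /=; apply: eq_bigr => p _.
    rewrite exchange_big /=; apply: eq_bigr => q _.
    rewrite -mulr_sumr; congr (_ * _).
    rewrite -F0 -(bernstein_monomial (FS (X p q)) (leq0n k)).
    by apply: eq_bigr => J _; rewrite !ffactn0 divr1 mul1r.
  rewrite mulr_sumr -big_split /=; apply: sumr_ge0 => J _.
  have JK : (J <= k)%N by rewrite -ltnS.
  pose t : R := J%:R / k%:R.
  have := IH _ (nW J) I (fun p => c p * t ^+ b p i) b x x0.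
  move=> /le_trans; apply; rewrite mulr_sumr -big_split /=; apply: ler_sum => p _.
  rewrite mulr_sumr -big_split /=; apply: ler_sum => q _.
  rewrite -/(X p q).
  have W0 : 0 <= W J (X p q) by exact: (diff_monotone_ge0 (nW J)).
  have := ffact_ratio R (bB p q) Bk JK; rewrite -/t.
  set r : R := (J ^_ _)%:R / _ => Hr.
  rewrite [c p * _ * (c q * _)]mulrACA -exprD.
  move: (W J (X p q)) W0 => w W0; set e : R := (B * B)%:R / _; set d := c p * c q.
  rewrite -subr_ge0.
  have -> : d * (r * w) + e * (`|d| * w) - d * t ^+ (b p i + b q i) * w =
    (d * (r - t ^+ (b p i + b q i)) + e * `|d|) * w by ring.
  rewrite mulr_ge0// -lerBlDl sub0r.
  apply: le_trans (ler_norm _) _; rewrite normrN normrM mulrC ler_wpM2r//.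
  apply: le_trans Hr _; rewrite ler_wpM2r ?invr_ge0 ?ler0n//.
  by rewrite ler_nat leq_mul2r bB orbT.
(* A negative [T] would contradict [TM] for large [k]. *)
rewrite leNgt; apply/negP => T0.
have := archi_boundP (normr_ge0 ((B * B)%:R * M / T)).
set m := Num.bound _ => Hm.
have m0 : (0 < m)%N.
  by rewrite -(ltr0n R); apply: le_lt_trans Hm.
have := TM (m + B)%N; rewrite -{1}(add0n B) ltn_add2r => /(_ m0).
rewrite addnK leNgt => /negP; apply.
have m0' : 0 < m%:R :> R by rewrite ltr0n.
have H : - ((B * B)%:R * M / T) < m%:R.
  by apply: le_lt_trans Hm; rewrite -normrN; exact: ler_norm.
rewrite mulrAC -ltrBrDl sub0r ltr_pdivrMr//.
have -> : (B * B)%:R * M = - ((B * B)%:R * M / T) * - T.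
  by field; rewrite lt_eqF.
by rewrite mulrC ltr_pM2l ?oppr_gt0.
Qed.

(** * Taylor expansion of powers of a quadratic *)

(** The generalised binomial coefficient. This recursion mirrors the derivative
    of [x `^ beta], which lowers the exponent by one. *)
Fixpoint gen_bin (R : realType) (beta : R) (k : nat) : R :=
  if k is k'.+1 then beta / k%:R * gen_bin (beta - 1) k' else 1.

Arguments gen_bin : simpl never.

Lemma gen_bin0 (R : realType) (beta : R) : gen_bin beta 0 = 1. Proof. by []. Qed.

Lemma gen_binS (R : realType) (beta : R) k :
  gen_bin beta k.+1 = beta / k.+1%:R * gen_bin (beta - 1) k.
Proof. by []. Qed.

Definition taylor1p (R : realType) (beta : R) (K : nat) : {poly R} :=
  \poly_(k < K) gen_bin beta k.

Lemma deriv_taylor1p (R : realType) (beta : R) K :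
  (taylor1p beta K.+1)^`() = beta *: taylor1p (beta - 1) K.
Proof.
apply/polyP => k; rewrite coef_deriv coefZ !coef_poly ltnS.
case: ltnP => _; last by rewrite mul0rn mulr0.
by rewrite gen_binS -[LHS]mulr_natr mulrAC divfK // pnatr_eq0.
Qed.

(** The derivative of the remainder for [beta] is [beta] times the remainder of
    one order less for [beta - 1], so the mean value theorem gives one power of
    [z] per step. The sign of [beta] passes to [beta - 1] and makes the remainder
    of order zero, [(1 + z) `^ beta], at most 1. *)
Lemma taylor1p_bound (R : realType) (beta : R) K : beta <= 0 ->
  exists C : R, forall z : R, 0 <= z ->
    `|(1 + z) `^ beta - (taylor1p beta K).[z]| <= C * z ^+ K.
Proof.
elim: K beta => [|K IH] beta b0.
  exists 1 => z z0; rewrite /taylor1p poly_def big_ord0 horner0 subr0 mul1r expr0.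
  rewrite ger0_norm ?powR_ge0// -[leRHS](powRr0 (1 + z)).
  by apply: ler_powR => //; rewrite lerDl.
have b1 : beta - 1 <= 0 by lra.
have [C HC] := IH _ b1.
exists (`|beta| * C) => z z0.
pose phi z := (1 + z) `^ beta - (taylor1p beta K.+1).[z].
pose dphi z := beta * ((1 + z) `^ (beta - 1) - (taylor1p (beta - 1) K).[z]).
have phi0 : phi 0 = 0.
  by rewrite /phi addr0 powR1 horner_coef0 coef_poly /= subrr.
have dp (t : R) : 0 <= t -> is_derive t 1 phi (dphi t).
  move=> t0; rewrite /phi /dphi mulrBr; apply: is_deriveB.
    have t1 : 0 < 1 + t by rewrite ltr_wpDr.
    have d1 : is_derive t 1 (fun z : R => 1 + z) (0 + 1 : R).
      exact: is_deriveD.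
    by have := is_derive1_comp (is_derive1_powR beta t1) d1; rewrite add0r mulr1.
  have -> : beta * (taylor1p (beta - 1) K).[t] = ((taylor1p beta K.+1)^`()).[t].
    by rewrite deriv_taylor1p hornerZ.
  exact: is_derive_poly.
have [||c] := @MVT_segment _ phi dphi 0 z z0.
- by move=> t; rewrite in_itv/= => /andP[/ltW t0 _]; exact: dp.
- apply: derivable_within_continuous => t; rewrite in_itv/= => /andP[t0 _].
  by have [] := dp _ t0.
rewrite in_itv/= => /andP[c0 cz]; rewrite phi0 !subr0 -/(phi z) => ->.
rewrite !normrM (ger0_norm z0) exprSr mulrA; apply: ler_wpM2r => //.
rewrite -mulrA; apply: ler_wpM2l => //; apply: le_trans (HC c c0) _.
apply: ler_wpM2l; last by rewrite lerXn2r.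
by have := HC 1 ler01; rewrite expr1n mulr1; apply: le_trans.
Qed.

Lemma powR_quad_taylor (R : realType) (beta : R) : beta <= 0 ->
  exists C : R -> R -> R, forall a b h : R, 0 <= a -> 0 <= b -> 0 <= h <= 1 ->
  `|(1 + (a * h + b * h ^+ 2)) `^ beta -
    (1 + gen_bin beta 1 * a * h + (gen_bin beta 1 * b + gen_bin beta 2 * a ^+ 2) * h ^+ 2
     + (gen_bin beta 2 * 2 * a * b + gen_bin beta 3 * a ^+ 3) * h ^+ 3
     + (gen_bin beta 2 * b ^+ 2 + gen_bin beta 3 * 3 * a ^+ 2 * b +
        gen_bin beta 4 * a ^+ 4)
        * h ^+ 4)| <= C a b * h ^+ 5.
Proof.
move=> b0; have [C HC] := taylor1p_bound 5 b0.
pose g k := gen_bin beta k.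
exists (fun a b => C * (a + b) ^+ 5 + (`|g 3%N| * (3 * a * b ^+ 2 + b ^+ 3) +
  `|g 4%N| * (4 * a ^+ 3 * b + 6 * a ^+ 2 * b ^+ 2 + 4 * a * b ^+ 3 + b ^+ 4))).
move=> a b h a0 b0' /andP[h0 h1].
set z := a * h + b * h ^+ 2.
have z0 : 0 <= z by rewrite addr_ge0 ?mulr_ge0 ?exprn_ge0.
set P := (1 + z) `^ beta; set t4 := (X in `|P - X|).
have := HC z z0; rewrite -/P.
(* As [z] is itself quadratic in [h], the Taylor polynomial in [z] also has
   terms of degree above 4 in [h]; they join the error. *)
have -> : (taylor1p beta 5).[z] = t4 + h ^+ 5 *
    (g 3%N * (3 * a * b ^+ 2 + b ^+ 3 * h) +
     g 4%N * (4 * a ^+ 3 * b + 6 * a ^+ 2 * b ^+ 2 * h +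
       4 * a * b ^+ 3 * h ^+ 2 + b ^+ 4 * h ^+ 3)).
  rewrite /taylor1p horner_poly !big_ord_recr big_ord0 /= gen_bin0.
  rewrite /t4 /g; set g1 := gen_bin beta 1; set g2 := gen_bin beta 2.
  set g3 := gen_bin beta 3; set g4 := gen_bin beta 4.
  rewrite /z.
  by ring.
set r : R := g 3%N * _ + _ => HP.
have hk (k : nat) : 0 <= h ^+ k <= 1 by rewrite exprn_ge0//= exprn_ile1.
have rb : `|r| <= `|g 3%N| * (3 * a * b ^+ 2 + b ^+ 3) +
  `|g 4%N| * (4 * a ^+ 3 * b + 6 * a ^+ 2 * b ^+ 2 + 4 * a * b ^+ 3 + b ^+ 4).
  have ab (i j : nat) : 0 <= a ^+ i * b ^+ j by rewrite mulr_ge0 ?exprn_ge0.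
  have le1 (u : R) k : 0 <= u -> 0 <= u * h ^+ k <= u.
    by move=> u0; have /andP[? ?] := hk k; rewrite mulr_ge0//= ler_piMr.
  apply: le_trans (ler_normD _ _) _; rewrite !normrM; apply: lerD.
    apply: ler_wpM2l => //.
    have := le1 _ 1%N (ab 0%N 3%N); have := ab 1%N 2%N.
    rewrite !expr0 !expr1 mul1r => ? /andP[? ?].
    by rewrite ger0_norm; lra.
  apply: ler_wpM2l => //.
  have := le1 _ 1%N (ab 2%N 2%N); have := le1 _ 2%N (ab 1%N 3%N).
  have := le1 _ 3%N (ab 0%N 4%N); have := ab 3%N 1%N.
  rewrite !expr0 !expr1 !mul1r => ? /andP[? ?] /andP[? ?] /andP[? ?].
  by rewrite ger0_norm; lra.
have zb : z ^+ 5 <= (a + b) ^+ 5 * h ^+ 5.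
  have zh : z <= (a + b) * h.
    rewrite mulrDl lerD2l; apply: ler_wpM2l => //.
    by rewrite expr2 ler_piMr.
  by rewrite -exprMn lerXn2r // nnegrE (le_trans z0).
have C0 : 0 <= C.
  by have := HC 1 ler01; rewrite expr1n mulr1; apply: le_trans.
have -> : P - t4 = (P - (t4 + h ^+ 5 * r)) + r * h ^+ 5 by ring.
apply: le_trans (ler_normD _ _) _; rewrite [leRHS]mulrDl; apply: lerD.
  apply: le_trans HP _; rewrite -mulrA; exact: ler_wpM2l.
have /andP[h50 _] := hk 5%N.
by rewrite normrM (ger0_norm h50); apply: ler_wpM2r.
Qed.

(** * The quartic inequality *)

(** The weights of the second difference. Summed against [j ^ d], they give 0 for
    [d < 2] and 2 for [d = 2]. *)
Definition diff2 (R : realType) (j : 'I_3) : R := if j == 1%N :> nat then -2 else 1.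

(** The points are [j v_o] with [j = 0, 1, 2]; [s] and [u] record the linear and
    the quadratic form on the vectors [v_o], so that the base of the power is the
    quadratic polynomial evaluated at [h (j v_o + l v_o')]. Second differences in
    both [j] and [l] remove every monomial of degree less than 2 in [j] or in
    [l]. The leading term in [h] is therefore [h ^ 4], and its coefficient comes
    from the monomial [j ^ 2 * l ^ 2] of the quartic Taylor term; it must be
    nonnegative. *)
Lemma quartic_test (R : realType) (beta : R) (O : finType) (w s : O -> R)
    (u : O -> O -> R) (a1 b1 : R) : beta <= 0 ->
  (forall o, 0 <= s o) -> (forall o o', 0 <= u o o') -> 0 <= a1 -> 0 <= b1 ->
  (forall h, 0 < h <= 1 ->
    0 <= \sum_(p : O * 'I_3) \sum_(q : O * 'I_3)
      (w p.1 * diff2 R p.2) * (w q.1 * diff2 R q.2) *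
      (1 + (a1 * (p.2%:R * s p.1 + q.2%:R * s q.1) * h +
            b1 * (p.2%:R ^+ 2 * u p.1 p.1 + q.2%:R ^+ 2 * u q.1 q.1 +
              2 * p.2%:R * q.2%:R * u p.1 q.1) * h ^+ 2)) `^ beta) ->
  0 <= \sum_o \sum_o' w o * w o' *
    (4 * (gen_bin beta 2 * b1 ^+ 2 * (2 * u o o * u o' o' + 4 * u o o' ^+ 2) +
      3 * gen_bin beta 3 * a1 ^+ 2 * b1 *
        (s o ^+ 2 * u o' o' + s o' ^+ 2 * u o o + 4 * s o * s o' * u o o') +
      6 * gen_bin beta 4 * a1 ^+ 4 * s o ^+ 2 * s o' ^+ 2)).
Proof.
move=> be0 s0 u0 a0 b0 H.
have [C HC] := powR_quad_taylor be0.
set gam := \sum_o _.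
pose a (p q : O * 'I_3) := a1 * (p.2%:R * s p.1 + q.2%:R * s q.1).
pose b (p q : O * 'I_3) := b1 * (p.2%:R ^+ 2 * u p.1 p.1 + q.2%:R ^+ 2 * u q.1 q.1 +
              2 * p.2%:R * q.2%:R * u p.1 q.1).
pose c (p : O * 'I_3) := w p.1 * diff2 R p.2.
pose t4 a b h : R := 1 + gen_bin beta 1 * a * h +
     (gen_bin beta 1 * b + gen_bin beta 2 * a ^+ 2) * h ^+ 2
     + (gen_bin beta 2 * 2 * a * b + gen_bin beta 3 * a ^+ 3) * h ^+ 3
     + (gen_bin beta 2 * b ^+ 2 + gen_bin beta 3 * 3 * a ^+ 2 * b +
        gen_bin beta 4 * a ^+ 4)
        * h ^+ 4.
have gamE h : gam * h ^+ 4 = \sum_p \sum_q c p * c q * t4 (a p q) (b p q) h.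
  rewrite -(pair_bigA _ (fun o j => \sum_q c (o, j) * c q *
     t4 (a (o, j) q) (b (o, j) q) h)) /=.
  rewrite /gam mulr_suml; apply: eq_bigr => o _.
  under [RHS]eq_bigr => j _.
    rewrite -(pair_bigA _ (fun o' l => c (o, j) * c (o', l) *
      t4 (a (o, j) (o', l)) (b (o, j) (o', l)) h)) /=.
    over.
  rewrite exchange_big mulr_suml /=; apply: eq_bigr => o' _.
  rewrite !(big_ord_recr, big_ord0) /= /c /a /b /t4 /diff2 /=.
  by ring.
pose M := \sum_p \sum_q `|c p * c q| * C (a p q) (b p q).
have a0' p q : 0 <= a p q.
  by rewrite /a mulr_ge0 ?addr_ge0 ?mulr_ge0.
have b0' p q : 0 <= b p q.
  by rewrite /b mulr_ge0 ?addr_ge0 ?mulr_ge0 ?exprn_ge0.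
have gM h : 0 < h <= 1 -> 0 <= gam + M * h.
  move=> h01; have /andP[h0 h1] := h01.
  have h40 : 0 < h ^+ 4 by rewrite exprn_gt0.
  rewrite -(pmulr_lge0 _ h40) mulrDl gamE -mulrA -exprS.
  apply: le_trans (H h h01) _.
  rewrite /M mulr_suml -big_split /=; apply: ler_sum => p _.
  rewrite mulr_suml -big_split /=; apply: ler_sum => q _.
  rewrite -/(a p q) -/(b p q) -/(c p) -/(c q).
  have := HC _ _ h (a0' p q) (b0' p q); rewrite -/(t4 _ _ h) (ltW h0) h1 => /(_ isT).
  rewrite -[X in _ <= _ + X]mulrA => HC'; rewrite -lerBlDl -mulrBr.
  by apply: le_trans (ler_norm _) _; rewrite normrM; apply: ler_wpM2l.
have M1 := gM 1; rewrite leNgt; apply/negP => g0.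
have M0 : 0 < M.
  by have := M1; rewrite ltr01 lexx mulr1 => /(_ isT); lra.
(* At this [h] the error is at most half of [- gam]. *)
pose h := Num.min 1 (- gam / (2 * M)).
have h0 : 0 < h by rewrite lt_min ltr01/= divr_gt0 ?oppr_gt0 ?mulr_gt0.
have h1 : h <= 1 by rewrite ge_min lexx.
have hM : M * h <= - gam / 2.
  have -> : - gam / 2 = M * (- gam / (2 * M)) by field; rewrite gt_eqF.
  by apply: ler_wpM2l; [exact: ltW | rewrite ge_min lexx orbT].
by have := gM h; rewrite h0 h1 => /(_ isT); lra.
Qed.

(** * From elementary symmetric polynomials to a quadratic form *)

Definition esym2 (R : realType) n (K : {set 'I_n}) (x : 'rV[R]_n) : R :=
  ((\sum_(i in K) x 0 i) ^+ 2 - \sum_(i in K) x 0 i ^+ 2) / 2.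

Definition indicator (R : realType) n (H : {set 'I_n}) : 'rV[R]_n :=
  \row_i (i \in H)%:R.

(** [esym2] is the second elementary symmetric polynomial, in the form that
    shows its signature; doubling it counts the ordered pairs. *)
Lemma esym2_pairs (R : realType) n (K : {set 'I_n}) (x : 'rV[R]_n) :
  esym2 K x * 2 = \sum_(p : 'I_n * 'I_n | [&& p.1 \in K, p.2 \in K & p.1 != p.2])
     x 0 p.1 * x 0 p.2.
Proof.
rewrite /esym2 divfK ?pnatr_eq0// expr2 big_distrlr /=.
rewrite pair_big_dep /= (bigID (fun p => p.1 == p.2)) /=.
rewrite [X in X + _ - _](_ : _ = \sum_(i in K) x 0 i ^+ 2); last first.
  rewrite (reindex (fun i : 'I_n => (i, i))) /=.
    by apply: eq_bigl => i; rewrite eqxx andbT andbb.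
  by exists fst => [i//|[i j]]; rewrite inE /= => /andP[_ /eqP ->].
by rewrite addrAC subrr add0r; apply: eq_bigl => p; rewrite andbA.
Qed.

(** The terms of [elem_sym] that survive when the variables in [H] tend to
    infinity. *)
Lemma sum_supersets (R : realType) n (H : {set 'I_n}) (x : 'rV[R]_n) :
  \sum_(A : {set 'I_n} | #|A| == #|H|.+2) (H \subset A)%:R * \prod_(i in A :\: H) x 0 i
  = esym2 (~: H) x.
Proof.
apply: (@mulIf _ 2); first by rewrite pnatr_eq0.
rewrite esym2_pairs.
rewrite (partition_big (fun p : 'I_n * 'I_n => H :|: [set p.1; p.2])
  (fun A => #|A| == #|H|.+2)) /=; last first.
  move=> [i j] /= /and3P[iH jH ij]; rewrite !inE in iH jH.
  rewrite finset.setUCA cardsU1 !inE (negPf ij) (negPf iH) /=.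
  by rewrite finset.setUC cardsU1 (negPf jH).
rewrite mulr_suml; apply: eq_bigr => A /eqP cA.
have [HA|HA] := boolP (H \subset A); last first.
  rewrite mul0r mul0r big_pred0// => p; apply: contraNF HA => /andP[_ /eqP <-].
  exact: finset.subsetUl.
have : #|A :\: H| == 2 by rewrite cardsDS// cA -addn2 addKn.
move=> /cards2P[a [b [ab AH]]].
have /finset.setDP[aA aH] : a \in A :\: H by rewrite AH !inE eqxx.
have /finset.setDP[bA bH] : b \in A :\: H by rewrite AH !inE eqxx orbT.
have AE : A = H :|: [set a; b].
  by rewrite -AH finset.setUC finset.setDE finset.setUIl
    [~: H :|: H]finset.setUC finset.setUCr finset.setIT; apply/esym/finset.setUidPl.
rewrite AH mul1r big_setU1 ?inE//= big_set1.
rewrite (bigD1 (a, b)) /=; last by rewrite !inE aH bH ab AE eqxx.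
rewrite (bigD1 (b, a)) /=; last first.
  rewrite !inE aH bH eq_sym ab AE
    [in H :|: [set b; a]]finset.setUC [[set b; a]]finset.setUC.
  by rewrite [_ :|: H]finset.setUC eqxx /= xpair_eqE negb_and eq_sym ab.
rewrite big_pred0 ?addr0; first by rewrite [x 0 b * _]mulrC -mulr2n mulr_natr.
move=> [i j] /=; rewrite !inE; apply/negbTE; apply/negP.
move=> /andP[/andP[/andP[/and3P[iH jH ij] /eqP E] n1] n2].
have : i \in H :|: [set a; b] by rewrite -AE -E !inE eqxx !orbT.
have : j \in H :|: [set a; b] by rewrite -AE -E !inE eqxx !orbT.
rewrite !inE (negPf iH) (negPf jH) /=.
move=> /orP[] /eqP jE /orP[] /eqP iE; subst i j; move: n1 n2 ij;
  by rewrite !eqxx.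
Qed.

(** [u ^ #|H| * E_m (x + u^-1 1_H)] as a polynomial in [u], so that its limit for
    [u] tending to 0 is an evaluation. *)
Definition rescaled_poly (R : realType) n m (H : {set 'I_n}) (x : 'rV[R]_n) : {poly R} :=
  \sum_(A : {set 'I_n} | #|A| == m) 'X^(#|H| - #|A :&: H|) *
    ((\prod_(i in A :&: H) (1 + x 0 i *: 'X)) * \prod_(i in A :\: H) (x 0 i)%:P).

Lemma rescaled_polyE (R : realType) n m (H : {set 'I_n}) (x : 'rV[R]_n) (u : R) :
  u != 0 ->
  (rescaled_poly m H x).[u] = u ^+ #|H| * elem_sym m (x + u^-1 *: indicator R H).
Proof.
move=> u0; rewrite /rescaled_poly horner_sum mulr_sumr; apply: eq_bigr => A _.
rewrite !hornerM !horner_prod hornerXn [in RHS](big_setID H) /= mulrA mulrA.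
congr (_ * _); last first.
  apply: eq_bigr => i; rewrite inE => /andP[iH _].
  by rewrite hornerC !mxE (negPf iH) mulr0 addr0.
have le : (#|A :&: H| <= #|H|)%N by rewrite subset_leq_card// finset.subsetIr.
rewrite -{2}(subnK le) exprD -mulrA -prodr_const -big_split /=.
congr (_ * _); apply: eq_bigr => i; rewrite inE => /andP[_ iH].
by rewrite !mxE iH mulr1 mulrDr mulfV// hornerD hornerZ hornerX hornerC addrC mulrC.
Qed.

Lemma rescaled_poly0 (R : realType) n m (H : {set 'I_n}) (x : 'rV[R]_n) :
  m = #|H|.+2 -> (rescaled_poly m H x).[0] = esym2 (~: H) x.
Proof.
move=> ->; rewrite -sum_supersets horner_sum; apply: eq_bigr => A _.
rewrite !hornerM !horner_prod hornerXn.
rewrite [X in _ * (X * _)]big1 ?mul1r; last first.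
  by move=> i _; rewrite hornerD hornerZ hornerX mulr0 addr0 hornerC.
congr (_ * _); last by apply: eq_bigr => i _; rewrite hornerC.
rewrite expr0n subn_eq0; congr (_%:R); congr nat_of_bool.
rewrite (geq_leqif (subset_leqif_cards (finset.subsetIr A H))).
by rewrite finset.eqEsubset finset.subsetIr finset.subsetI subxx andbT.
Qed.

Lemma esym2_gt0 (R : realType) n (K : {set 'I_n}) (x : 'rV[R]_n) :
  (1 < #|K|)%N -> pos_orthant x -> 0 < esym2 K x.
Proof.
move=> /card_gt1P[a [b [aK bK ab]]] x0.
rewrite -(pmulr_lgt0 _ (ltr0n R 2)) esym2_pairs (bigD1 (a, b)) /= ?aK ?bK//.
rewrite ltr_wpDr ?mulr_gt0//; apply: sumr_ge0 => p _.
by rewrite mulr_ge0// ltW.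
Qed.

Lemma elem_sym_ge0 (R : realType) n m (x : 'rV[R]_n) :
  pos_orthant x -> 0 <= elem_sym m x.
Proof.
by move=> x0; apply: sumr_ge0 => A _; apply: prodr_ge0 => i _; exact/ltW/x0.
Qed.

(** Translation by [u^-1 1_H] and multiplication by the constant
    [(u ^ #|H|) `^ (- alpha)] preserve the signs of differences, and so does the
    limit [u -> 0]. *)
Lemma diff_monotone_esym2 (R : realType) (m n : nat) (alpha h : R) (H : {set 'I_n}) l :
  0 <= h -> m = #|H|.+2 -> (m <= n)%N ->
  diff_monotone h l (fun x : 'rV[R]_n => elem_sym m x `^ (- alpha)) ->
  diff_monotone h l (fun x : 'rV[R]_n => esym2 (~: H) x `^ (- alpha)).
Proof.
move=> h0 mH mn nf.
pose t k : R := harmonic k.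
have t0 k : 0 < t k by exact: harmonic_gt0.
apply: (@diff_monotone_lim _ _ h l (fun k x => (t k ^+ #|H|) `^ (- alpha) *
   elem_sym m (x + (t k)^-1 *: indicator R H) `^ (- alpha))) => //.
  move=> k; apply: diff_monotone_scale; first exact: powR_ge0.
  apply: (@diff_monotone_shift _ _ h l (fun x => elem_sym m x `^ (- alpha))) => //.
  apply: nonnegZ; first by rewrite invr_ge0 ltW.
  by move=> i; rewrite mxE ler0n.
move=> x x0.
have H2 : (1 < #|~: H|)%N by rewrite cardsCs finset.setCK card_ord; lia.
have e0 := esym2_gt0 H2 x0.
have E k : (t k ^+ #|H|) `^ (- alpha) *
   elem_sym m (x + (t k)^-1 *: indicator R H) `^ (- alpha) =
   (rescaled_poly m H x).[t k] `^ (- alpha).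
  rewrite rescaled_polyE ?gt_eqF// powRM ?exprn_ge0 ?(ltW (t0 k))//.
  apply: elem_sym_ge0; apply: pos_orthantD => //; apply: nonnegZ.
    by rewrite invr_ge0 ltW.
  by move=> i; rewrite mxE ler0n.
under eq_cvg do rewrite E.
have ct : (t k @[k --> \oo] --> (0 : R))%classic by exact: cvg_harmonic.
have cp : ((rescaled_poly m H x).[t k] @[k --> \oo] --> esym2 (~: H) x)%classic.
  rewrite -(rescaled_poly0 x mH); apply: (cvg_comp _ _ ct).
  exact: continuous_horner.
have ce : {for esym2 (~: H) x, continuous (fun y : R => y `^ (- alpha))}.
  apply: differentiable_continuous; apply/derivable1_diffP.
  by apply: derivable_powR; rewrite in_itv/= e0.
exact: (continuous_cvg _ ce cp).
Qed.

(** * The exponents of the quadratic form *)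

Lemma big_option (R : realType) (T : finType) (F : option T -> R) :
  \sum_o F o = F None + \sum_k F (Some k).
Proof.
rewrite (bigD1 None) //=; congr (_ + _).
rewrite (reindex_omap Some id) /=; last by case.
by apply: eq_bigl => k; rewrite eqxx.
Qed.

(** The value of the quartic inequality for [p(y) = \sum_k y_k^2 -
    c (\sum_k y_k)^2], where [s] and [u] are taken on the unit vectors [Some k] and
    on the all-ones vector [None], and [2 / N], [1 / (N (N - 1))] are the
    coefficients of [E_2] at [(1, ..., 1)] normalised to the value 1 there. It is a
    quadratic polynomial in [c], and [c] is chosen to minimise it. *)
Lemma quartic_value (R : realType) (T : finType) (K : {set T}) (alpha : R)
  (c N : R) (s : option T -> R) (u : option T -> option T -> R) :
  let G o o' := 4 * (gen_bin (- alpha) 2 * (1 / (N * (N - 1))) ^+ 2 *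
      (2 * u o o * u o' o' + 4 * u o o' ^+ 2) +
      3 * gen_bin (- alpha) 3 * (2 / N) ^+ 2 * (1 / (N * (N - 1))) *
        (s o ^+ 2 * u o' o' + s o' ^+ 2 * u o o + 4 * s o * s o' * u o o') +
      6 * gen_bin (- alpha) 4 * (2 / N) ^+ 4 * s o ^+ 2 * s o' ^+ 2) in
  let w o : R := if o is Some k then (k \in K)%:R else - c in
  N = #|K|%:R -> 1 < N -> 0 < alpha -> c = (2 * alpha + 2) / (N * (2 * alpha + 1)) ->
  s None = N -> u None None = N ^+ 2 - N ->
  {in K, forall k, s (Some k) = 1} ->
  {in K, forall k, u (Some k) None = N - 1} ->
  {in K, forall k, u None (Some k) = N - 1} ->
  {in K &, forall k k', u (Some k) (Some k') = (k != k')%:R} ->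
  \sum_o \sum_o' w o * w o' * G o o' =
  8 * alpha * (alpha + 1) * (2 * alpha + 2 - N) / (N ^+ 2 * (N - 1) * (2 * alpha + 1)).
Proof.
move=> G w NK N1 a0 cE sN uNN sK uKN uNK uK.
pose P s s' v v' v'' : R := 4 * (gen_bin (- alpha) 2 * (1 / (N * (N - 1))) ^+ 2 *
      (2 * v * v' + 4 * v'' ^+ 2) +
      3 * gen_bin (- alpha) 3 * (2 / N) ^+ 2 * (1 / (N * (N - 1))) *
        (s ^+ 2 * v' + s' ^+ 2 * v + 4 * s * s' * v'') +
      6 * gen_bin (- alpha) 4 * (2 / N) ^+ 4 * s ^+ 2 * s' ^+ 2).
have sumK (F : T -> R) y : {in K, forall k, F k = y} ->
    \sum_k (k \in K)%:R * F k = N * y.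
  move=> Fy; transitivity (\sum_(k in K) y).
    rewrite [RHS]big_mkcond; apply: eq_bigr => k _.
    by case: ifPn => kK; rewrite ?mul0r// mul1r Fy.
  by rewrite sumr_const NK mulr_natl.
have Eo o y : (forall k, k \in K -> G o (Some k) = y) ->
    \sum_o' w o * w o' * G o o' = w o * (N * y - c * G o None).
  move=> Gy; rewrite big_option /= -(sumK (fun k => G o (Some k))) //.
  rewrite mulrBr mulr_sumr addrC; congr (_ + _).
    by apply: eq_bigr => k _; rewrite -[LHS]mulrA.
  by move: (G o None) => g; ring.
rewrite big_option (@Eo None (P N 1 (N ^+ 2 - N) 0 (N - 1))); last first.
  by move=> k kK; rewrite /G /P sN uNN (sK _ kK) (uNK _ kK) (uK _ _ kK kK) eqxx.
have EK k : k \in K -> \sum_o' w (Some k) * w o' * G (Some k) o' =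
    (P 1 1 0 0 0 + (N - 1) * P 1 1 0 0 1) - c * P 1 N 0 (N ^+ 2 - N) (N - 1).
  move=> kK; rewrite big_option /= kK addrC; congr (_ + _).
    rewrite (bigD1 k)//= kK !mul1r; congr (_ + _).
      by rewrite /G /P !sK// uK// eqxx.
    transitivity (\sum_(k' in K :\ k) P 1 1 0 0 1).
      rewrite [LHS]big_mkcond [RHS]big_mkcond; apply: eq_bigr => k' _ /=.
      rewrite !inE; case: eqP => //= /eqP k'k; rewrite mul1r.
      case: ifPn => k'K; rewrite ?mul0r// mul1r /G /P !sK// !uK// !eqxx.
      by rewrite eq_sym k'k.
    rewrite sumr_const -mulr_natl; congr (_ * _).
    by rewrite NK (cardsD1 k K) kK natrD addrAC subrr add0r.
  by rewrite mul1r mulNr /G /P sN uNN sK// uKN// uK// eqxx.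
rewrite [X in _ + X](_ : _ = N * ((P 1 1 0 0 0 + (N - 1) * P 1 1 0 0 1)
    - c * P 1 N 0 (N ^+ 2 - N) (N - 1))); last first.
  rewrite -[in RHS](sumK (fun k => \sum_o' w (Some k) * w o' * G (Some k) o')) //.
  apply: eq_bigr => k _; case: (boolP (k \in K)) => kK; first by rewrite mul1r.
  by rewrite mul0r big1// => o' _; rewrite /w (negPf kK) !mul0r.
rewrite /G sN uNN /= /P !gen_binS !gen_bin0 cE.
field.
by apply/and3P; split; rewrite gt_eqF//; lra.
Qed.

(** [Some k] is the [k]-th unit vector, [None] the all-ones vector: the second
    difference along the former discretises [y_k ^ 2], along the latter
    [(\sum_k y_k) ^ 2]. *)
Definition test_vector n (o : option 'I_n) (i : 'I_n) : nat :=
  if o is Some k then i == k else 1%N.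

Definition test_sum (R : realType) n (K : {set 'I_n}) (o : option 'I_n) : R :=
  \sum_(i in K) (test_vector o i)%:R.

Definition test_dot (R : realType) n (K : {set 'I_n}) (o o' : option 'I_n) : R :=
  \sum_(i in K) (test_vector o i)%:R * (test_vector o' i)%:R.

Lemma test_dotC (R : realType) n (K : {set 'I_n}) o o' :
  test_dot R K o o' = test_dot R K o' o.
Proof. by apply: eq_bigr => i _; rewrite mulrC. Qed.

Lemma test_dot_le (R : realType) n (K : {set 'I_n}) o o' :
  test_dot R K o o' <= test_sum R K o * test_sum R K o'.
Proof.
rewrite /test_sum mulr_suml; apply: ler_sum => i iK; apply: ler_wpM2l => //.
by rewrite (bigD1 i) //= lerDl sumr_ge0.
Qed.

Lemma test_dotN (R : realType) n (K : {set 'I_n}) o :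
  test_dot R K o None = test_sum R K o.
Proof. by apply: eq_bigr => i _; rewrite mulr1. Qed.

Lemma test_sumN (R : realType) n (K : {set 'I_n}) : test_sum R K None = #|K|%:R.
Proof. by rewrite /test_sum sumr_const. Qed.

Lemma sum_test_vectorS (R : realType) n (K : {set 'I_n}) k (F : 'I_n -> R) : k \in K ->
  \sum_(i in K) (test_vector (Some k) i)%:R * F i = F k.
Proof.
move=> kK; rewrite (bigD1 k) //= eqxx mul1r big1 ?addr0// => i /andP[_ /negPf ->].
by rewrite mul0r.
Qed.

Lemma test_sumS (R : realType) n (K : {set 'I_n}) k : k \in K ->
  test_sum R K (Some k) = 1.
Proof.
move=> kK; rewrite -[RHS](sum_test_vectorS (fun=> 1) kK).
by apply: eq_bigr => i _; rewrite mulr1.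
Qed.

Lemma esym2_test (R : realType) n (K : {set 'I_n}) (N h j l : R) o o' (x : 'rV[R]_n) :
  N = #|K|%:R -> 1 < N ->
  (forall i, x 0 i = 1 + h * (j * (test_vector o i)%:R + l * (test_vector o' i)%:R)) ->
  let s := test_sum R K in
  let u o o' := test_sum R K o * test_sum R K o' - test_dot R K o o' in
  esym2 K x = N * (N - 1) / 2 *
   (1 + (2 / N * (j * s o + l * s o') * h +
         1 / (N * (N - 1)) * (j ^+ 2 * u o o + l ^+ 2 * u o' o' +
            2 * j * l * u o o') * h ^+ 2)).
Proof.
move=> NK N1 xE s u; rewrite /esym2.
have -> : \sum_(i in K) x 0 i = N + h * (j * s o + l * s o').
  under eq_bigr => i _ do rewrite xE.
  by rewrite big_split /= sumr_const -NK -mulr_sumr big_split /= -!mulr_sumr.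
have -> : \sum_(i in K) x 0 i ^+ 2 = N + 2 * h * (j * s o + l * s o') +
    h ^+ 2 * (j ^+ 2 * test_dot R K o o + l ^+ 2 * test_dot R K o' o' +
       2 * j * l * test_dot R K o o').
  rewrite NK -sumr_const /s /test_sum /test_dot.
  rewrite !(mulr_sumr, =^~ big_split) /=.
  by apply: eq_bigr => i _; rewrite xE; ring.
rewrite /u /s; field; apply/andP; split; rewrite gt_eqF//; lra.
Qed.

Lemma esym2_diff_monotone_ge (R : realType) n (K : {set 'I_n}) (alpha : R) :
  (1 < #|K|)%N -> 0 < alpha ->
  (forall h : R, 0 < h -> diff_monotone h (rev (enum 'I_n))
    (fun x => esym2 K x `^ (- alpha))) ->
  #|K|%:R - 2 <= 2 * alpha.
Proof.
move=> K2 a0 nK; pose N : R := #|K|%:R.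
have N1 : 1 < N by rewrite ltr1n.
pose c := (2 * alpha + 2) / (N * (2 * alpha + 1)).
pose w (o : option 'I_n) : R := if o is Some k then (k \in K)%:R else - c.
pose s := test_sum R K.
pose u o o' := s o * s o' - test_dot R K o o'.
have s0 o : 0 <= s o by apply: sumr_ge0 => i _.
have u0 o o' : 0 <= u o o' by rewrite subr_ge0 test_dot_le.
have b0 : - alpha <= 0 by rewrite oppr_le0 ltW.
have a10 : 0 <= 2 / N by rewrite divr_ge0.
have q0 : 0 < N * (N - 1) by rewrite mulr_gt0 ?subr_gt0//; lra.
have b10 : 0 <= 1 / (N * (N - 1)) by rewrite divr_ge0 ?ltW.
have psd h : 0 < h <= 1 ->
    0 <= \sum_(p : option 'I_n * 'I_3) \sum_(q : option 'I_n * 'I_3)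
      (w p.1 * diff2 R p.2) * (w q.1 * diff2 R q.2) *
      (1 + (2 / N * (p.2%:R * s p.1 + q.2%:R * s q.1) * h +
            1 / (N * (N - 1)) * (p.2%:R ^+ 2 * u p.1 p.1 + q.2%:R ^+ 2 * u q.1 q.1 +
              2 * p.2%:R * q.2%:R * u p.1 q.1) * h ^+ 2)) `^ (- alpha).
  move=> /andP[h0 _].
  have x0 : pos_orthant (const_mx 1 : 'rV[R]_n) by move=> i; rewrite mxE.
  have Q0 : 0 < (N * (N - 1) / 2) `^ (- alpha) by rewrite powR_gt0 ?divr_gt0.
  rewrite -(pmulr_rge0 _ Q0).
  have := diff_monotone_psd (ltW h0) (nK h h0)
    (fun p : option 'I_n * 'I_3 => w p.1 * diff2 R p.2)
    (fun p i => (p.2 * test_vector p.1 i)%N) x0.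
  congr (0 <= _); rewrite mulr_sumr; apply: eq_bigr => p _.
  rewrite mulr_sumr; apply: eq_bigr => q _.
  rewrite !lattice_ptE (@esym2_test _ _ K N h p.2%:R q.2%:R p.1 q.1)//; last first.
    by move=> i; rewrite !mxE !natrM.
  rewrite powRM ?divr_ge0 ?(ltW q0)//; first by rewrite mulrCA.
  have h0' := ltW h0.
  apply: addr_ge0 => //; apply: addr_ge0; apply: mulr_ge0; rewrite ?exprn_ge0//;
    apply: mulr_ge0 => //.
    by apply: addr_ge0; apply: mulr_ge0.
  by rewrite !addr_ge0// mulr_ge0 ?u0 ?exprn_ge0 ?mulr_ge0.
have := quartic_test b0 s0 u0 a10 b10 psd.
rewrite (@quartic_value _ _ K alpha c N s u) //.
- rewrite ler_pdivlMr; last first.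
    by rewrite !mulr_gt0 ?exprn_gt0 ?subr_gt0//; lra.
  rewrite mul0r pmulr_rge0; last by rewrite !mulr_gt0//; lra.
  by rewrite -/N; lra.
- exact: test_sumN.
- by rewrite /u /s test_dotN test_sumN expr2.
- by move=> k kK; exact: test_sumS.
- by move=> k kK; rewrite /u /s test_dotN test_sumN test_sumS// mul1r.
- by move=> k kK; rewrite /u /s test_dotC test_dotN test_sumN test_sumS// mulr1.
- move=> k k' kK k'K; rewrite /u /s !test_sumS// mul1r /test_dot sum_test_vectorS//=.
  by case: eqP => _; rewrite ?subrr ?subr0.
Qed.

(** For negative [alpha] the power would increase along the coordinates in [K]. *)
Lemma esym2_diff_monotone_exponent_ge0 (R : realType) n (K : {set 'I_n}) (alpha h : R) :
  (1 < #|K|)%N -> 0 < h ->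
  diff_monotone h (rev (enum 'I_n)) (fun x => esym2 K x `^ (- alpha)) -> 0 <= alpha.
Proof.
move=> K2 h0 nK; rewrite leNgt; apply/negP => a0.
have /card_gt0P[k kK] : (0 < #|K|)%N by exact: ltnW.
have N1 : 1 < #|K|%:R :> R by rewrite ltr1n.
set N : R := #|K|%:R in N1.
have x0 : pos_orthant (const_mx 1 : 'rV[R]_n) by move=> i; rewrite mxE.
have := diff_monotone_nabla nK (_ : k \in _) x0; rewrite mem_rev mem_enum => /(_ isT).
rewrite /nabla subr_ge0 leNgt => /negP; apply.
have -> : esym2 K (const_mx 1) = N * (N - 1) / 2.
  rewrite (@esym2_test _ _ K N 0 0 0 None None)//; first by rewrite /=; ring.
  by move=> i; rewrite !mxE mul0r addr0.
have -> : esym2 K (const_mx 1 + h *: delta_mx 0 k) = N * (N - 1) / 2 * (1 + 2 / N * h).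
  rewrite (@esym2_test _ _ K N h 1 0 (Some k) None)//; last first.
    by move=> i; rewrite !mxE mul0r addr0 mul1r.
  rewrite test_sumS// /test_dot sum_test_vectorS//= eqxx /= mulr1n.
  by ring.
have q0 : 0 < N * (N - 1) / 2 by rewrite divr_gt0// mulr_gt0 ?subr_gt0//; lra.
have d0 : 0 < 2 / N * h by rewrite mulr_gt0// divr_gt0//; lra.
apply: gt0_ltr_powR; rewrite ?oppr_gt0// ?nnegrE.
- by rewrite mulr_ge0 ?ltW//; lra.
- by rewrite mulr_ge0 ?ltW//; lra.
- by rewrite ltr_pMr// ltrDl.
Qed.

Theorem theorem6p6 (R : realType) (m n : nat) (alpha : R)
  (hm : (2 <= m)%N) (hmn : (m < n)%N)
  (hcm : completely_monotone (fun x : 'rV[R]_n => elem_sym m x `^ (- alpha))) :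
  alpha = 0 \/ (n%:R - m%:R) / 2 <= alpha.
Proof.
(* Any set of [m - 2] variables may be sent to infinity. *)
pose H : {set 'I_n} := [set:: take (m - 2) (enum 'I_n)].
have cH : #|H| = (m - 2)%N.
  rewrite cardsE (card_uniqP _) ?take_uniq ?enum_uniq// size_takel//.
  by rewrite size_enum_ord; lia.
have cK : #|~: H| = (n - m + 2)%N by rewrite cardsCs finset.setCK card_ord cH; lia.
have K2 : (1 < #|~: H|)%N by lia.
have mH : m = #|H|.+2 by lia.
have nK (h : R) : 0 < h ->
    diff_monotone h (rev (enum 'I_n)) (fun x => esym2 (~: H) x `^ (- alpha)).
  move=> h0; apply: (diff_monotone_esym2 (ltW h0) mH (ltnW hmn)).
  exact: completely_monotone_diff_monotone.
have := esym2_diff_monotone_exponent_ge0 K2 ltr01 (nK 1 ltr01).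
rewrite le_eqVlt => /orP[/eqP <-|a0]; [by left | right].
have := esym2_diff_monotone_ge K2 a0 nK.
by rewrite cK natrD natrB ?(ltnW hmn)// ler_pdivrMr//; lra.
Qed.
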